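(* Let $m,n\ge 0$ be integers. For every $I\in\mathbb S$ and every $q\in L_I$, and for either choice of sign (upper signs together, or lower signs together), $$H^Q_{m,n}(q,\overline q)=\frac{(\mp I)^{m+n}}{\pi}\,e^{|q|^2}\int_{L_I}\xi^{m}\,\overline{\xi}^{\,n}\,e^{-|\xi|^2\pm I(\xi\overline q+\overline\xi q)}\,d\lambda_I(\xi),$$ where $d\lambda_I$ is the Lebesgue measure on the slice $L_I$.
   Context: $\mathbb H$ is the algebra of real quaternions, $\mathbb S=\{I\in\mathbb H: I^2=-1\}$, and for $I\in\mathbb S$ the slice is $L_I=\mathbb R+\mathbb R I$ (a copy of $\mathbb C$); $d\lambda_I(\xi)=dx\,dy$ for $\xi=x+yI$. $\overline q$ is the quaternionic conjugate, $|q|^2=q\overline q$. For integers $m,n\ge0$, $$H^Q_{m,n}(q,\overline q)=\sum_{k=0}^{\min(m,n)}(-1)^k k!\binom mk\binom nk q^{m-k}\overline q^{\,n-k}.$$ *)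

(* Defs.v *)
From HB Require Import structures.
From mathcomp Require Import all_boot all_order all_algebra.
From mathcomp Require Import ring.
From mathcomp Require Import all_classical all_reals all_analysis.

Set Implicit Arguments.
Unset Strict Implicit.
Unset Printing Implicit Defensive.

Import Order.TTheory GRing.Theory Num.Theory.
Import numFieldNormedType.Exports.

Local Open Scope ring_scope.

(* [Quat a b c d] is the quaternion a + b i + c j + d k. *)
Record quat (R : Type) : Type :=
  Quat { qre : R; qi : R; qj : R; qk : R }.

Section QuatChoice.
Variable R : Type.

Definition tuple_of_quat (q : quat R) : R * R * R * R :=
  (qre q, qi q, qj q, qk q).

Definition quat_of_tuple (t : R * R * R * R) : quat R :=
  let: (a, b, c, d) := t in Quat a b c d.

Lemma tuple_of_quatK : cancel tuple_of_quat quat_of_tuple.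
Proof. by case. Qed.

End QuatChoice.

HB.instance Definition _ (R : eqType) :=
  Equality.copy (quat R) (can_type (@tuple_of_quatK R)).
HB.instance Definition _ (R : choiceType) :=
  Choice.copy (quat R) (can_type (@tuple_of_quatK R)).

Section QuatAlgebra.
Variable R : comNzRingType.
Implicit Types p q r : quat R.

Definition qzero : quat R := Quat 0 0 0 0.

Definition qone : quat R := Quat 1 0 0 0.

Definition qopp q : quat R := Quat (- qre q) (- qi q) (- qj q) (- qk q).

Definition qadd p q : quat R :=
  Quat (qre p + qre q) (qi p + qi q) (qj p + qj q) (qk p + qk q).

Definition qmul p q : quat R :=
  Quat (qre p * qre q - qi p * qi q - qj p * qj q - qk p * qk q)
       (qre p * qi q + qi p * qre q + qj p * qk q - qk p * qj q)
       (qre p * qj q - qi p * qk q + qj p * qre q + qk p * qi q)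
       (qre p * qk q + qi p * qj q - qj p * qi q + qk p * qre q).

Definition qscale (a : R) q : quat R :=
  Quat (a * qre q) (a * qi q) (a * qj q) (a * qk q).

Definition qconj q : quat R := Quat (qre q) (- qi q) (- qj q) (- qk q).

Fact qaddA : associative qadd.
Proof. by move=> [????] [????] [????]; congr Quat => /=; ring. Qed.

Fact qaddC : commutative qadd.
Proof. by move=> [????] [????]; congr Quat => /=; ring. Qed.

Fact qadd0 : left_id qzero qadd.
Proof. by move=> [????]; congr Quat => /=; ring. Qed.

Fact qaddN : left_inverse qzero qopp qadd.
Proof. by move=> [????]; congr Quat => /=; ring. Qed.

HB.instance Definition _ :=
  GRing.isZmodule.Build (quat R) qaddA qaddC qadd0 qaddN.

Fact qmulA : associative qmul.
Proof. by move=> [????] [????] [????]; congr Quat => /=; ring. Qed.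

Fact qmul1l : left_id qone qmul.
Proof. by move=> [????]; congr Quat => /=; ring. Qed.

Fact qmul1r : right_id qone qmul.
Proof. by move=> [????]; congr Quat => /=; ring. Qed.

Fact qmulDl : left_distributive qmul +%R.
Proof. by move=> [????] [????] [????]; congr Quat => /=; ring. Qed.

Fact qmulDr : right_distributive qmul +%R.
Proof. by move=> [????] [????] [????]; congr Quat => /=; ring. Qed.

Fact qone_neq0 : qone != 0.
Proof. by apply/eqP => -[] /eqP; rewrite oner_eq0. Qed.

HB.instance Definition _ :=
  GRing.Zmodule_isNzRing.Build (quat R)
    qmulA qmul1l qmul1r qmulDl qmulDr qone_neq0.

Fact qscaleA a b q : qscale a (qscale b q) = qscale (a * b) q.
Proof. by case: q => ????; congr Quat => /=; ring. Qed.

Fact qscale1 : left_id 1 qscale.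
Proof. by move=> [????]; congr Quat => /=; ring. Qed.

Fact qscaleDr : right_distributive qscale +%R.
Proof. by move=> a [????] [????]; congr Quat => /=; ring. Qed.

Fact qscaleDl q : {morph qscale^~ q : a b / a + b}.
Proof. by move=> a b; case: q => ????; congr Quat => /=; ring. Qed.

HB.instance Definition _ :=
  GRing.Zmodule_isLmodule.Build R (quat R)
    qscaleA qscale1 qscaleDr qscaleDl.

Fact qscaleAl (a : R) p q : a *: (p * q) = (a *: p) * q.
Proof. by case: p q => ???? [????]; congr Quat => /=; ring. Qed.

HB.instance Definition _ :=
  GRing.Lmodule_isLalgebra.Build R (quat R) qscaleAl.

Fact qscaleAr (a : R) p q : a *: (p * q) = p * (a *: q).
Proof. by case: p q => ???? [????]; congr Quat => /=; ring. Qed.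

HB.instance Definition _ :=
  GRing.Lalgebra_isAlgebra.Build R (quat R) qscaleAr.

End QuatAlgebra.

Section QuatAnalysis.
Variable R : realType.
Implicit Types (m n : nat) (I p q : quat R) (F : quat R -> quat R).

Definition qnorm q : R := Num.sqrt (qre (q * qconj q)).

Lemma qnorm_sqr q : (qnorm q ^+ 2)%:A = q * qconj q.
Proof.
have E : qre (q * qconj q) = qre q ^+ 2 + qi q ^+ 2 + qj q ^+ 2 + qk q ^+ 2.
  by case: q => a b c d /=; ring.
rewrite /qnorm sqr_sqrtr; last by rewrite E !addr_ge0 ?sqr_ge0.
by case: q {E} => a b c d; congr Quat => /=; ring.
Qed.

(* Limit in H = R^4, computed coordinatewise. *)
Definition qlim (u : nat -> quat R) : quat R :=
  Quat (limn (fun N => qre (u N))) (limn (fun N => qi (u N)))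
       (limn (fun N => qj (u N))) (limn (fun N => qk (u N))).

Definition qexp q : quat R :=
  qlim (fun N => \sum_(0 <= k < N) (k`!%:R)^-1 *: q ^+ k).

Definition imag_units : set (quat R) := [set I | I ^+ 2 = -1]%classic.

Definition slice_pt I (z : R * R) : quat R := z.1%:A + z.2 *: I.

Definition slice I : set (quat R) := range (slice_pt I).

Definition lebesgue2 := (@lebesgue_measure R \x @lebesgue_measure R)%E.

(* Integrability and integral over L_I for d lambda_I = dx dy, xi = x + y I;
   the integral of an H-valued function is taken coordinatewise. *)
Definition slice_integrable I F : Prop :=
  [/\ lebesgue2.-integrable setT (fun z => (qre (F (slice_pt I z)))%:E),
      lebesgue2.-integrable setT (fun z => (qi (F (slice_pt I z)))%:E),
      lebesgue2.-integrable setT (fun z => (qj (F (slice_pt I z)))%:E)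
    & lebesgue2.-integrable setT (fun z => (qk (F (slice_pt I z)))%:E)].

Definition slice_integral I F : quat R :=
  Quat (\int[lebesgue2]_z qre (F (slice_pt I z)))
       (\int[lebesgue2]_z qi (F (slice_pt I z)))
       (\int[lebesgue2]_z qj (F (slice_pt I z)))
       (\int[lebesgue2]_z qk (F (slice_pt I z))).

(* H^Q_{m,n}(q, conj q) *)
Definition hermiteQ m n q : quat R :=
  \sum_(k < (minn m n).+1)
    ((-1) ^+ k * k`!%:R * 'C(m, k)%:R * 'C(n, k)%:R) *:
      (q ^+ (m - k) * qconj q ^+ (n - k)).

End QuatAnalysis.

(* Main.v *)
Require Import Defs.
From mathcomp Require Import all_boot all_order all_algebra.
From mathcomp Require Import ring lra zify complex.
From mathcomp Require Import all_classical all_reals all_analysis.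
From mathcomp Require Import measurable_realfun.

Import Order.TTheory GRing.Theory Num.Theory.
Local Open Scope classical_set_scope.
Local Open Scope ring_scope.

(** The slice through [I] is a copy of the complex plane, so the identity is
    one about complex numbers.  Write [q = a + b I] and [xi = x + y I].  The
    exponent is [- (x^2 + y^2) + 2 eps (a x + b y) I], and its exponential is
    [e^(-(x^2+y^2))] times [cos u + I sin u] with [u = 2 eps (a x + b y)].
    The sign is absorbed by replacing [(a, b)] with [(eps a, eps b)], because
    [H_{m,n}] only picks up [eps^(m+n)] when [q] is replaced by [eps q].

    In one variable, let [h_k] be the rescaled Hermite polynomials
    ([h_{k+1} = a h_k - (k/2) h_{k-1}]).  Integrating the derivative of
    [x^k e^(-x^2) cos (2 a x + t)] over the line gives a recurrence for the
    moments; differentiating under the integral sign gives the case [k = 0].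
    Together ([gauss_momentE])
      int x^k e^(-x^2) cos (2 a x + t) dx
        = sqrt pi e^(-a^2) h_k(a) cos (t + k pi / 2).
    A free phase [t] treats cosine and sine, and hence real and imaginary
    parts, at the same time.  By Fubini ([integral_gauss_wave2]) the plane
    moment of [x^j y^l] is [pi e^(-(a^2+b^2)) h_j(a) h_l(b)] with the phase
    advanced by [(j + l) pi / 2].

    The polynomial [xi^m conj(xi)^n] is homogeneous of degree [m + n] in
    [(x, y)], so the phase shift is the same for all its monomials: it is the
    factor [I^(m+n)], which [(- eps I)^(m+n)] cancels together with
    [eps^(m+n)].  What remains is the
    umbral identity [homog_hermite]: replacing every [x^j y^l] in
    [(x + i y)^m (x - i y)^n] by [h_j(a) h_l(b)] yields
    [H_{m,n}(a + i b, a - i b)].  It holds since both sides satisfy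
    [T(m+1, n) = z T(m, n) - n T(m, n-1)]; on the umbral side the last term
    is the Wirtinger derivative of the monomial.

    The quaternionic exponential is a limit of partial sums, so its value on
    the slice needs an argument too ([cvg_complex_exp]): the derivative of
    [t |-> e^(-t z) sum_{k <= N} (t z)^k / k!] is
    [- e^(-t z) z (t z)^N / N!], which is uniformly small on [0, 1]. *)

Set Implicit Arguments.
Unset Strict Implicit.
Unset Printing Implicit Defensive.
Import numFieldNormedType.Exports.

(** * The umbral Hermite identity *)

Section Umbral.
Variable K : numFieldType.
Implicit Types (v : nat -> nat -> K) (p : {poly K}) (a b c x y z w : K).

(** A univariate [p] of degree at most [N] stands for the form
    [y^N p(x / y)]; [homog N v p] is the value of that form when each
    monomial [x^j y^l] is given the value [v j l]. *)
Definition homog N v p : K := \sum_(j < N.+1) p`_j * v j (N - j)%N.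

Lemma homogD N v p q : homog N v (p + q) = homog N v p + homog N v q.
Proof.
by rewrite -big_split; apply: eq_bigr => j _; rewrite coefD mulrDl.
Qed.

Lemma homogZ N v a p : homog N v (a *: p) = a * homog N v p.
Proof. by rewrite mulr_sumr; apply: eq_bigr => j _; rewrite coefZ mulrA. Qed.

(** Multiplying the form by [x + c y] shifts the two indices of the table. *)
Lemma homog_mulXaddC N v c p : (size p <= N.+1)%N ->
  homog N.+1 v (('X + c%:P) * p) =
  homog N (fun j l => v j.+1 l) p + c * homog N (fun j l => v j l.+1) p.
Proof.
move=> sp; rewrite mulrDl homogD mul_polyC homogZ; congr (_ + c * _).
  rewrite /homog big_ord_recl coefXM mul0r add0r.
  by apply: eq_bigr => j _; rewrite coefXM /= /bump /= add1n subSS.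
rewrite /homog big_ord_recr /= nth_default // mul0r addr0.
by apply: eq_bigr => j _; rewrite subSn // -ltnS.
Qed.

(** For [c = i] this is the form [(x + i y)^m (x - i y)^n] at [y = 1]. *)
Definition split_poly c m n : {poly K} :=
  ('X + c%:P) ^+ m * ('X - c%:P) ^+ n.

Lemma split_polyC c m n : split_poly (- c) n m = split_poly c m n.
Proof. by rewrite /split_poly polyCN opprK mulrC. Qed.

Lemma split_polySl c m n :
  split_poly c m.+1 n = ('X + c%:P) * split_poly c m n.
Proof. by rewrite /split_poly exprS mulrA. Qed.

Lemma size_split_poly c m n : (size (split_poly c m n) <= (m + n).+1)%N.
Proof.
rewrite (leq_trans (size_polyMleq _ _)) // size_exp_XsubC.
by rewrite -[c in 'X + c%:P]opprK polyCN size_exp_XsubC addSn addnS.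
Qed.

Lemma homog_monomial c x y m n :
  homog (m + n) (fun j l => x ^+ j * y ^+ l) (split_poly c m n) =
  (x + c * y) ^+ m * (x - c * y) ^+ n.
Proof.
have step N d p : (size p <= N.+1)%N ->
    homog N.+1 (fun j l => x ^+ j * y ^+ l) (('X + d%:P) * p) =
    (x + d * y) * homog N (fun j l => x ^+ j * y ^+ l) p.
  move=> sp; rewrite homog_mulXaddC // /homog !mulr_sumr -big_split.
  by apply: eq_bigr => j _; rewrite !exprS /=; ring.
elim: m n => [|m IH] n.
  rewrite -split_polyC; elim: n => [|n IH].
    by rewrite /homog big_ord1 /split_poly !expr0 !mulr1 coef1.
  rewrite add0n split_polySl step; last first.
    by rewrite (leq_trans (size_split_poly _ _ _)) // addn0.
  by rewrite -[n]/(0 + n)%N IH !expr0 !mul1r exprS mulNr.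
by rewrite split_polySl addSn step ?size_split_poly // IH exprS; ring.
Qed.

(** With [H_k] the physicists' Hermite polynomial, this is [2^(-k) H_k(a)]. *)
Fixpoint hermite1 a k : K :=
  match k with
  | 0 => 1
  | k'.+1 => if k' is k''.+1
             then a * hermite1 a k' - k'%:R / 2 * hermite1 a k'' else a
  end.

Lemma hermite1S a k :
  hermite1 a k.+1 = a * hermite1 a k - k%:R / 2 * hermite1 a k.-1.
Proof. by case: k => [|k] //=; rewrite mulr1 !mul0r subr0. Qed.

Definition hermite_table a b j l : K := hermite1 a j * hermite1 b l.

(** On the Hermite table, multiplication by [x] acts as [a - (1/2) d/dx] and
    multiplication by [y] as [b - (1/2) d/dy].  By Euler's relation, the
    [y]-derivative of the form of degree [N.+1] attached to [p] is attached
    to [(N.+1) p - 'X p']. *)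
Lemma homog_hermite_tableS a b N c p : (size p <= N.+2)%N ->
  homog N.+2 (hermite_table a b) (('X + c%:P) * p) =
  (a + c * b) * homog N.+1 (hermite_table a b) p -
  2^-1 * homog N (hermite_table a b)
           (p^`() + c *: (N.+1%:R *: p - 'X * p^`())).
Proof.
move=> sp; rewrite homog_mulXaddC //.
have -> : homog N.+1 (fun j l => hermite_table a b j.+1 l) p =
    a * homog N.+1 (hermite_table a b) p -
    2^-1 * homog N (hermite_table a b) p^`().
  rewrite [2^-1 * _]mulr_sumr.
  have -> : \sum_(j < N.+1) 2^-1 * (p^`()`_j * hermite_table a b j (N - j)) =
      \sum_(j < N.+2)
        p`_j * (j%:R / 2 * hermite1 a j.-1 * hermite1 b (N.+1 - j)).
    rewrite [RHS]big_ord_recl /= !mul0r mulr0 add0r; apply: eq_bigr => j _.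
    rewrite coef_deriv /hermite_table /= /bump /= add1n subSS -mulr_natr.
    by ring.
  rewrite /homog mulr_sumr -sumrB; apply: eq_bigr => j _.
  by rewrite /hermite_table hermite1S; ring.
have -> : homog N.+1 (fun j l => hermite_table a b j l.+1) p =
    b * homog N.+1 (hermite_table a b) p -
    2^-1 * homog N (hermite_table a b) (N.+1%:R *: p - 'X * p^`()).
  rewrite [2^-1 * _]mulr_sumr.
  have -> : \sum_(j < N.+1) 2^-1 *
        ((N.+1%:R *: p - 'X * p^`())`_j * hermite_table a b j (N - j)) =
      \sum_(j < N.+2) p`_j *
        (hermite1 a j * ((N.+1 - j)%:R / 2 * hermite1 b (N.+1 - j).-1)).
    rewrite [RHS]big_ord_recr /= subnn mul0r mul0r mulr0 mulr0 addr0.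
    apply: eq_bigr => j _; have jN : (j <= N)%N by rewrite -ltnS.
    rewrite coefB coefZ coefXM subSn //= /hermite_table.
    suff -> : (if (j : nat) == 0%N then 0 else p^`()`_j.-1) = j%:R * p`_j.
      by rewrite -subSn // natrB ?(leqW jN) //; ring.
    by case: (nat_of_ord j) => [|i]; rewrite /= ?mul0r // coef_deriv mulr_natl.
  rewrite /homog mulr_sumr -sumrB; apply: eq_bigr => j _.
  by rewrite /hermite_table hermite1S; ring.
by rewrite homogD homogZ; ring.
Qed.

(** The operator [d/dx + c d/dy] kills [x + c y] and multiplies the
    derivative in [x - c y] by [1 - c^2 = 2]. *)
Lemma split_poly_wirtinger c m n : c ^+ 2 = -1 ->
  (split_poly c m n)^`() +
    c *: ((m + n)%:R *: split_poly c m n - 'X * (split_poly c m n)^`()) =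
  (2 * n%:R) *: split_poly c m n.-1.
Proof.
move=> cc; rewrite /split_poly derivM.
have dx d k : (('X + d%:P) ^+ k)^`() = k%:R *: ('X + d%:P) ^+ k.-1 :> {poly K}.
  by rewrite deriv_exp derivD derivX derivC addr0 mul1r scaler_nat.
have -> : ('X - c%:P) = 'X + (- c)%:P :> {poly K} by rewrite polyCN.
rewrite !dx -!mul_polyC.
set d := (- c)%:P; set e := c%:P.
have de : d = - e by rewrite /d polyCN.
have ee : e * e = -1 by rewrite -polyCM -expr2 cc polyCN.
rewrite natrD !polyCD rmorphM /= !rmorph_nat.
have key (A B A' B' : {poly K}) :
    A' * ('X + e) = m%:R * A -> B' * ('X + d) = n%:R * B ->
    A' * B + A * B' +
      e * ((m%:R + n%:R) * (A * B) - 'X * (A' * B + A * B')) = 2 * (A * B').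
  move=> hA hB.
  have -> : A' * B + A * B' +
      e * ((m%:R + n%:R) * (A * B) - 'X * (A' * B + A * B')) =
      (A' * B + A * B') * (1 - e * 'X) +
      e * (m%:R * A * B + A * (n%:R * B)) by ring.
  (* this is where [c ^+ 2 = -1] makes the [A'] terms cancel *)
  have -> : 1 - e * 'X = - e * ('X + e) by rewrite mulNr mulrDr ee; ring.
  rewrite -hA -hB de.
  have -> : (A' * B + A * B') * (- e * ('X + e)) +
      e * (A' * ('X + e) * B + A * (B' * ('X - e))) =
      - 2 * (e * e) * (A * B') by ring.
  by rewrite ee; ring.
rewrite key; first by ring.
- by case: (m) => [|i]; rewrite /= ?mul0r // -mulrA -exprSr.
- by case: (n) => [|i]; rewrite /= ?mul0r // -mulrA -exprSr.
Qed.

Lemma homog_hermite_rec a b c m n : c ^+ 2 = -1 ->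
  homog (m + n).+1 (hermite_table a b) (split_poly c m.+1 n) =
  (a + c * b) * homog (m + n) (hermite_table a b) (split_poly c m n) -
  n%:R * homog (m + n).-1 (hermite_table a b) (split_poly c m n.-1).
Proof.
move=> cc; rewrite split_polySl.
have := size_split_poly c m n; have := split_poly_wirtinger m n cc.
case E : (m + n)%N => [|N] D sp /=; last first.
  by rewrite homog_hermite_tableS // D homogZ; field.
move/eqP: E; rewrite addn_eq0 => /andP[/eqP-> /eqP->].
rewrite homog_mulXaddC ?(leq_trans (size_split_poly _ _ _)) //.
rewrite /homog !big_ord_recl !big_ord0 /split_poly /hermite_table /=.
by rewrite !expr0 !mulr1 coef1 /=; ring.
Qed.

(** The complex Hermite polynomial with [z] and its conjugate [w] treated as
    independent variables, which is what the recurrence below needs. *)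
Definition hermite2 m n z w : K :=
  \sum_(k < (minn m n).+1)
    (-1) ^+ k * k`!%:R * 'C(m, k)%:R * 'C(n, k)%:R *
    (z ^+ (m - k) * w ^+ (n - k)).

Lemma hermite2_widen B m n z w : (minn m n < B)%N ->
  hermite2 m n z w = \sum_(k < B)
    (-1) ^+ k * k`!%:R * 'C(m, k)%:R * 'C(n, k)%:R *
    (z ^+ (m - k) * w ^+ (n - k)).
Proof.
move=> mnB; rewrite /hermite2 (big_ord_widen B (fun k : nat =>
  (-1) ^+ k * k`!%:R * 'C(m, k)%:R * 'C(n, k)%:R *
  (z ^+ (m - k) * w ^+ (n - k)))) //.
rewrite big_mkcond; apply: eq_bigr => k _ /=; case: ltnP => // mnk.
move: mnk; rewrite gtn_min => /orP[] /bin_small->;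
  by rewrite ?mulr0 !mul0r.
Qed.

Lemma hermite20n n z w : hermite2 0 n z w = w ^+ n.
Proof. by rewrite /hermite2 min0n big_ord1 expr0 !bin0 !subn0 !mul1r. Qed.

(** Pascal's rule in [m] splits each coefficient; the second half is shifted
    by one and absorbed with [(k+1) 'C(n, k+1) = n 'C(n-1, k)]. *)
Lemma hermite2Sn m n z w :
  hermite2 m.+1 n z w = z * hermite2 m n z w - n%:R * hermite2 m n.-1 z w.
Proof.
pose B := (m + n).+2.
have lt i j : (i <= m.+1)%N -> (minn i j < B)%N.
  move=> im; rewrite (leq_ltn_trans (geq_minl _ _)) //.
  by rewrite (leq_ltn_trans im) // !ltnS leq_addr.
clearbody B.
rewrite (hermite2_widen (B := B.+1)) ?leqW ?lt //.
rewrite (hermite2_widen (B := B.+1) (m := m) (n := n)) ?leqW ?lt //.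
rewrite (hermite2_widen (B := B) (m := m) (n := n.-1)) ?lt //.
rewrite [RHS]addrC big_ord_recl [in RHS]big_ord_recl /= mulrDr [RHS]addrCA.
congr (_ + _); first by rewrite !bin0 !subn0 exprS; ring.
rewrite !mulr_sumr -sumrN -big_split; apply: eq_bigr => k _ /=.
rewrite /bump /= add1n subSS binS natrD.
have absorb : k.+1`!%:R * 'C(n, k.+1)%:R * w ^+ (n - k.+1) =
    n%:R * (k`!%:R * 'C(n.-1, k)%:R * w ^+ (n.-1 - k)) :> K.
  case: (n) => [|n']; first by rewrite bin0n /= mulr0 !mul0r.
  rewrite subSS factS natrM !mulrA; congr (_ * _).
  rewrite -!natrM; congr _%:R.
  by rewrite mulnAC -mul_bin_diag /=; lia.
have shift : z * ('C(m, k.+1)%:R * z ^+ (m - k.+1)) =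
    'C(m, k.+1)%:R * z ^+ (m - k) :> K.
  have [mk|mk] := leqP m k.
    by rewrite (bin_small (n := m)) ?ltnS // !mul0r mulr0.
  by rewrite -[(m - k)%N]prednK ?subn_gt0 // -subnS exprS; ring.
transitivity ((-1) ^+ k.+1 *
  ('C(m, k.+1)%:R * z ^+ (m - k) + 'C(m, k)%:R * z ^+ (m - k)) *
  (k.+1`!%:R * 'C(n, k.+1)%:R * w ^+ (n - k.+1))); first by ring.
rewrite mulrDr mulrDl [LHS]addrC.
by congr (_ + _); [rewrite absorb (exprS (-1)) | rewrite -shift]; ring.
Qed.

Lemma hermite2_sign m n e z w : e ^+ 2 = 1 ->
  hermite2 m n (e * z) (e * w) = e ^+ (m + n) * hermite2 m n z w.
Proof.
move=> ee; rewrite /hermite2 mulr_sumr; apply: eq_bigr => -[k /=].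
rewrite ltnS leq_min => /andP[km kn] _.
have -> : e ^+ (m + n) = e ^+ (m - k) * e ^+ (n - k).
  rewrite -exprD -[in LHS](subnK km) -[in LHS](subnK kn) addnACA addnn exprD.
  by rewrite -muln2 mulnC exprM ee expr1n mulr1.
by rewrite !exprMn; ring.
Qed.

(** Both sides obey the same recurrence in [m].  For [m = 0], exchanging the
    two factors (that is, [c] with [- c]) turns the recurrence in [m] into one
    in [n] whose lower-order term vanishes. *)
Lemma homog_hermite a b c m n : c ^+ 2 = -1 ->
  homog (m + n) (hermite_table a b) (split_poly c m n) =
  hermite2 m n (a + c * b) (a - c * b).
Proof.
move=> cc; elim: m n => [|m IH] n; last first.
  rewrite addSn homog_hermite_rec // IH hermite2Sn; congr (_ - _).
  by case: n => [|n]; rewrite ?mul0r // addnS IH.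
have cc' : (- c) ^+ 2 = -1 by rewrite sqrrN.
rewrite hermite20n -split_polyC add0n.
elim: n => [|n IHn].
  by rewrite /homog big_ord1 /split_poly /hermite_table /= !expr0 !mulr1 coef1.
have := homog_hermite_rec a b n 0 cc'; rewrite addn0 => ->.
by rewrite mul0r subr0 IHn exprS mulNr.
Qed.

End Umbral.

(** * Elementary derivatives *)

Section Derivatives.
Variable R : realType.
Implicit Types b t x : R.

Lemma is_derive_affine b t x :
  is_derive x (1 : R) (fun x => b * x + t) b.
Proof. by apply: is_derive_eq; rewrite addr0 /GRing.scale /= mulr1. Qed.

Lemma is_derive_affine_cos b t x :
  is_derive x (1 : R) (fun x => cos (b * x + t)) (- b * sin (b * x + t)).
Proof.
have := @is_derive1_comp _ cos (fun x => b * x + t) _ _ _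
  (is_derive_cos _) (is_derive_affine b t x).
by rewrite mulrC mulrN -mulNr.
Qed.

Lemma is_derive_affine_sin b t x :
  is_derive x (1 : R) (fun x => sin (b * x + t)) (b * cos (b * x + t)).
Proof.
have := @is_derive1_comp _ sin (fun x => b * x + t) _ _ _
  (is_derive_sin _) (is_derive_affine b t x).
by rewrite mulrC.
Qed.

Lemma is_derive_expR_linear b x :
  is_derive x (1 : R) (fun x => expR (b * x)) (b * expR (b * x)).
Proof.
have h : is_derive x (1 : R) (fun x => b * x) b.
  by apply: is_derive_eq; rewrite /GRing.scale /= mulr1.
have := @is_derive1_comp _ expR (fun x => b * x) _ _ _ (is_derive_expR _) h.
by rewrite mulrC.
Qed.

Lemma is_derive_powX k x :
  is_derive x (1 : R) (fun x => x ^+ k) (k%:R * x ^+ k.-1).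
Proof.
have -> : (fun x : R => x ^+ k) = (id : R -> R) ^+ k.
  by apply/funext => y; rewrite exprfctE.
by apply: is_derive_eq; exact: mulr1.
Qed.

Lemma cosDpihalf x : cos (x + pi / 2) = - sin x.
Proof. by rewrite cosD cos_pihalf sin_pihalf; ring. Qed.

Lemma cosBpihalf x : cos (x - pi / 2) = sin x.
Proof. by rewrite cosB cos_pihalf sin_pihalf; ring. Qed.

End Derivatives.

(** * Functions dominated by a Gaussian moment *)

Section GaussDomination.
Variable R : realType.
Notation mu := (@lebesgue_measure R).

Lemma integrable_gauss_half :
  mu.-integrable setT (EFin \o (fun x : R => expR (- (x ^+ 2 / 2)))).
Proof.
(* the integrand is a multiple of the standard normal density *)
have h := integrable_normal_pdf (0 : R) 1.
have s0 : (1 : R) != 0 by rewrite oner_eq0.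
have p0 := lt0r_neq0 (normal_peak_gt0 s0).
have := integrableZl measurableT (normal_peak (1 : R))^-1 h.
apply: eq_integrable => // x _ /=.
rewrite /normal_pdf (negbTE s0) /normal_fun subr0 expr1n -EFinM mulKf //.
by rewrite mulNr.
Qed.

(** Half of the Gaussian decay pays for the power: [|x|^k <= 1 + x^(2k)], and
    [(x^2/2)^k / k! <= e^(x^2/2)]. *)
Lemma normX_gauss_le k : exists2 C : R, 0 <= C &
  forall x : R, `|x| ^+ k * expR (- x ^+ 2) <= C * expR (- (x ^+ 2 / 2)).
Proof.
exists (1 + 2 ^+ k * k`!%:R) => [|x].
  by rewrite addr_ge0 // mulr_ge0 // exprn_ge0.
have -> : - x ^+ 2 = - (x ^+ 2 / 2) + - (x ^+ 2 / 2) by field.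
rewrite expRD mulrA ler_wpM2r ?expR_ge0 //.
rewrite -[leRHS]mulr1 -[X in _ <= _ * X](expR0 R) -(subrr (x ^+ 2 / 2)).
rewrite expRD mulrA ler_wpM2r ?expR_ge0 //.
have y0 : 0 <= x ^+ 2 / 2 by rewrite divr_ge0 // sqr_ge0.
have e1 : 1 <= expR (x ^+ 2 / 2).
  by apply: le_trans (expR_ge1Dx _); rewrite lerDl.
rewrite mulrDl mul1r.
have [x1|x1] := leP `|x| 1.
  rewrite (le_trans (exprn_ile1 _ (normr_ge0 x) x1)) // (le_trans e1) // lerDl.
  by rewrite !mulr_ge0 ?expR_ge0 // exprn_ge0.
have : `|x| ^+ k <= 2 ^+ k * k`!%:R * ((x ^+ 2 / 2) ^+ k / k`!%:R).
  rewrite expr_div_n -exprM.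
  have -> : 2 ^+ k * k`!%:R * (x ^+ (2 * k) / 2 ^+ k / k`!%:R) = x ^+ (2 * k).
    by field; rewrite expf_neq0 //= pnatr_eq0 -lt0n fact_gt0.
  rewrite exprM -real_normK ?num_real // -exprM.
  by rewrite ler_weXn2l // ?leq_pmull // ltW.
move=> /le_trans; apply.
rewrite (@le_trans _ _ (2 ^+ k * k`!%:R * expR (x ^+ 2 / 2))) //; last first.
  by rewrite lerDr expR_ge0.
rewrite ler_wpM2l ?mulr_ge0 ?exprn_ge0 //.
case: k => [|k]; first by rewrite expr0 fact0 divr1.
by apply: le_trans (expR_ge1Dxn k y0); rewrite lerDr.
Qed.

Lemma integrable_gauss_dominated k (f : R -> R) : measurable_fun setT f ->
  (forall x, `|f x| <= `|x| ^+ k * expR (- x ^+ 2)) ->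
  mu.-integrable setT (EFin \o f).
Proof.
move=> mf hf; have [C C0 hC] := normX_gauss_le k.
have := integrableZl measurableT C integrable_gauss_half.
apply: le_integrable => //; first exact/measurable_EFinP.
move=> x _ /=; rewrite lee_fin [leRHS]ger0_norm.
  exact: le_trans (hf x) (hC x).
by rewrite mulr_ge0 // ?expR_ge0.
Qed.

Lemma integrable_abs_gauss k :
  mu.-integrable setT (EFin \o (fun x : R => `|x| ^+ k * expR (- x ^+ 2))).
Proof.
apply: (integrable_gauss_dominated (k := k)).
  apply: measurable_funM; last exact: measurable_gauss_fun.
  by apply: measurable_funX; exact: normr_measurable.
by move=> x; rewrite ger0_norm // mulr_ge0 ?expR_ge0 ?exprn_ge0.
Qed.

Lemma cvg_gauss_dominated k (f : R -> R) (u : nat -> R) :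
  (forall x, `|f x| <= `|x| ^+ k * expR (- x ^+ 2)) ->
  `|u n| @[n --> \oo] --> +oo -> f (u n) @[n --> \oo] --> 0.
Proof.
(* the bound for [k.+1] leaves a factor [`|u n|^-1] for [k] *)
move=> hf hu; have [C C0 hC] := normX_gauss_le k.+1.
apply: norm_cvg0.
have hg : forall n, `|u n| > 0 -> `|f (u n)| <= C * `|u n|^-1.
  move=> n un0; rewrite ler_pdivlMr // mulrC.
  apply: le_trans (ler_wpM2l (normr_ge0 _) (hf _)) _.
  rewrite mulrA -exprS (le_trans (hC _)) // ler_piMr // expR_le1 oppr_le0.
  by rewrite divr_ge0 // sqr_ge0.
apply: (@squeeze_cvgr _ _ _ _ (cst 0) (fun n => C * `|u n|^-1)).
- near=> n; rewrite normr_ge0 hg //=.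
  by near: n; move/cvgryPgt : hu; exact.
- exact: cvg_cst.
- rewrite -[X in _ --> X](mulr0 C); apply: cvgMr.
  by apply/gtr0_cvgV0 => //; near=> n; near: n; move/cvgryPgt : hu; exact.
Unshelve. all: by end_near. Qed.

(** The fundamental theorem of calculus on [-n, n], then [n --> \oo] by
    dominated convergence. *)
Lemma integral_derivative_eq0 (f F : R -> R) : continuous f ->
  mu.-integrable setT (EFin \o f) ->
  (forall x : R, is_derive x (1 : R) F (f x)) ->
  (F n%:R) @[n --> \oo] --> 0 -> (F (- n%:R)) @[n --> \oo] --> 0 ->
  \int[mu]_x f x = 0.
Proof.
move=> cf intf dF Fp Fm.
have mf : measurable_fun setT f by exact: continuous_measurable_fun.
pose I n := [set` `[(- n%:R : R), n%:R]].
have mI n : measurable (I n) by exact: measurable_itv.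
have dc : (\int[mu]_x ((EFin \o f) \_ (I n)) x)%E @[n --> \oo] -->
    (\int[mu]_x (f x)%:E)%E.
  have [] := @dominated_convergence _ _ _ mu setT measurableT
    (fun n => (EFin \o f) \_ (I n)) (EFin \o f) (fun x => `|f x|%:E) => //.
  - move=> n; apply/(measurable_restrictT _ (mI n)).
    by apply/measurable_EFinP; exact: measurable_funTS.
  - exact/measurable_EFinP.
  - apply: aeW => x _.
    apply: cvg_near_cst; near=> n.
    rewrite patchE mem_set // /I /= in_itv /= -ler_norml.
    by near: n; exact: nbhs_infty_ger.
  - exact: integrable_abse intf.
  - apply: aeW => x n _; rewrite patchE; case: ifP => _ //=.
    by rewrite normr0 lee_fin.
have key : forall n, (0 < n)%N ->
    (\int[mu]_x ((EFin \o f) \_ (I n)) x = (F n%:R - F (- n%:R))%:E)%E.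
  move=> n n0; rewrite -integral_mkcond EFinB; apply: continuous_FTC2.
  - by rewrite gtrN ?ltr0n.
  - exact: continuous_subspaceT.
  - have cF : continuous F.
      by move=> x; exact/differentiable_continuous/derivable1_diffP/ex_derive.
    split=> [x _||]; first exact: ex_derive.
      exact/cvg_at_right_filter/cF.
    exact/cvg_at_left_filter/cF.
  - by move=> x _; rewrite derive1E; exact: derive_val.
rewrite /Rintegral; suff -> : (\int[mu]_x (f x)%:E = 0)%E by [].
apply: (cvg_unique _ dc) => //.
have h : (F n%:R - F (- n%:R))%:E @[n --> \oo] --> (0 : \bar R)%E.
  apply: cvg_EFin; first exact: nearW.
  by rewrite -[X in _ --> X](subr0 0); exact: cvgB.
apply: cvg_trans h; apply: near_eq_cvg; near=> n; rewrite key //.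
by near: n; exists 1%N.
Unshelve. all: by end_near. Qed.

End GaussDomination.

(** * Gaussian moments with a trigonometric factor: one variable *)

Section GaussMoment.
Variable R : realType.
Notation mu := (@lebesgue_measure R).
Implicit Types a b t x : R.

Definition gauss_wave k a t x : R :=
  x ^+ k * (expR (- x ^+ 2) * cos (2 * a * x + t)).

Lemma gauss_wave_le k a t x :
  `|gauss_wave k a t x| <= `|x| ^+ k * expR (- x ^+ 2).
Proof.
rewrite normrM normrX ler_wpM2l ?exprn_ge0 // normrM ger0_norm ?expR_ge0 //.
by rewrite ler_piMr ?expR_ge0 // ler_norml cos_geN1 cos_le1.
Qed.

(** Writing [- sin s] as [cos (s + pi / 2)] keeps the derivative inside the
    family. *)
Lemma is_derive_gauss_wave k a t x :
  is_derive x (1 : R) (gauss_wave k a t)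
    (k%:R * gauss_wave k.-1 a t x - 2 * gauss_wave k.+1 a t x +
     2 * a * gauss_wave k a (t + pi / 2) x).
Proof.
have hE : is_derive x (1 : R) (fun x => expR (- x ^+ 2))
    (- 2 * x * expR (- x ^+ 2)).
  have h2 : is_derive x (1 : R) (fun x => - x ^+ 2) (- (2 * x)).
    by have := is_deriveN (is_derive_powX 2 x).
  have := @is_derive1_comp _ expR (fun x => - x ^+ 2) _ _ _
    (is_derive_expR _) h2.
  by rewrite mulrC mulNr.
have := is_deriveM (is_derive_powX k x)
  (is_deriveM hE (is_derive_affine_cos (2 * a) t x)).
congr is_derive.
rewrite mulrfctE /gauss_wave addrA cosDpihalf (exprS x k) /GRing.scale /=.
by ring.
Qed.

Lemma continuous_gauss_wave k a t : continuous (gauss_wave k a t).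
Proof.
have d := is_derive_gauss_wave k a t; move=> x.
exact/differentiable_continuous/derivable1_diffP/ex_derive.
Qed.

Lemma measurable_gauss_wave k a t : measurable_fun setT (gauss_wave k a t).
Proof.
by apply: continuous_measurable_fun; exact: continuous_gauss_wave.
Qed.

Lemma integrable_gauss_wave k a t :
  mu.-integrable setT (EFin \o gauss_wave k a t).
Proof.
exact: integrable_gauss_dominated (measurable_gauss_wave k a t)
  (gauss_wave_le k a t).
Qed.

Definition gauss_moment k a t := \int[mu]_x gauss_wave k a t x.

(** Integration by parts: the derivative of [gauss_wave k a t] has integral
    zero. *)
Lemma gauss_momentS k a t :
  gauss_moment k.+1 a t =
  a * gauss_moment k a (t + pi / 2) + k%:R / 2 * gauss_moment k.-1 a t.
Proof.
pose f x := k%:R * gauss_wave k.-1 a t x - 2 * gauss_wave k.+1 a t x +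
     2 * a * gauss_wave k a (t + pi / 2) x.
have intZ c j s :
    mu.-integrable setT (EFin \o (fun x => c * gauss_wave j a s x)).
  have := integrableZl measurableT c (integrable_gauss_wave j a s).
  by apply: eq_integrable.
have intB : mu.-integrable setT (EFin \o (fun x =>
    k%:R * gauss_wave k.-1 a t x - 2 * gauss_wave k.+1 a t x)).
  have := integrableB measurableT (intZ k%:R k.-1 t) (intZ 2 k.+1 t).
  by apply: eq_integrable.
have intf : mu.-integrable setT (EFin \o f).
  have := integrableD measurableT intB (intZ (2 * a) k (t + pi / 2)).
  by apply: eq_integrable.
have : \int[mu]_x f x = 0.
  apply: (@integral_derivative_eq0 _ _ (gauss_wave k a t)) => //.
  - move=> x; apply: cvgD; [apply: cvgB|];
      by apply: cvgMr; exact: continuous_gauss_wave.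
  - exact: is_derive_gauss_wave.
  - apply: (cvg_gauss_dominated (k := k)); first exact: gauss_wave_le.
    under eq_cvg do rewrite ger0_norm //; exact: cvgr_idn.
  - apply: (cvg_gauss_dominated (k := k)); first exact: gauss_wave_le.
    under eq_cvg do rewrite normrN ger0_norm //; exact: cvgr_idn.
rewrite /f RintegralD // RintegralB // !RintegralZl //;
  try exact: integrable_gauss_wave.
rewrite -!/(gauss_moment _ _ _) => h.
apply: (@mulfI _ 2) => //; move: h; lra.
Qed.

(** Differentiation under the integral sign brings down a factor [x]; the
    resulting first moment is reduced to the zeroth by [gauss_momentS]. *)
Lemma gauss_moment0_derive a t :
  is_derive a (1 : R) (gauss_moment 0 ^~ t) (- (2 * a) * gauss_moment 0 a t).
Proof.
pose f a x := gauss_wave 0 a t x.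
have df b x : is_derive b (1 : R) (f ^~ x) (2 * gauss_wave 1 b (t + pi / 2) x).
  have := is_deriveM (is_derive_cst (expR (- x ^+ 2)) b (1:R))
    (is_derive_affine_cos (2 * x) t b).
  have -> : f ^~ x = cst (expR (- x ^+ 2)) * (fun b => cos (2 * x * b + t)).
    by apply/funext => c; rewrite /f /gauss_wave expr0 mul1r mulrAC.
  congr is_derive.
  rewrite scaler0 addr0 /gauss_wave addrA cosDpihalf expr1 /GRing.scale /=.
  by rewrite mulrAC; ring.
have d1E b x : partial1of2 f b x = 2 * gauss_wave 1 b (t + pi / 2) x.
  by rewrite partial1of2E; exact: (@derive_val _ _ _ _ _ _ _ (df b x)).
have aI : `]a - 1, a + 1[%classic a by rewrite /= in_itv /=; lra.
have intf b : `]a - 1, a + 1[%classic b -> mu.-integrable setT (EFin \o f b).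
  by move=> _; exact: integrable_gauss_wave.
have dfI b x : `]a - 1, a + 1[%classic b -> setT x -> derivable (f ^~ x) b 1.
  by move=> _ _; exact: (@ex_derive _ _ _ _ _ _ _ (df b x)).
pose G (x : R) := 2 * (`|x| ^+ 1 * expR (- x ^+ 2)).
have G0 x : 0 <= G x by rewrite !mulr_ge0 ?expR_ge0.
have intG : mu.-integrable setT (EFin \o G).
  have := integrableZl measurableT 2 (integrable_abs_gauss R 1).
  by apply: eq_integrable.
have Gub b x : `]a - 1, a + 1[%classic b -> setT x ->
    `|partial1of2 f b x| <= G x.
  move=> _ _; rewrite d1E normrM ger0_norm // ler_wpM2l //.
  exact: gauss_wave_le.
have drv := derivable_under_integral measurableT aI intf dfI G0 intG Gub.
have val := differentiation_under_integral measurableT aI intf dfI G0 intG Gub.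
have -> : - (2 * a) * gauss_moment 0 a t = 'D_1 (gauss_moment 0 ^~ t) a.
  rewrite -derive1E [RHS]val.
  under eq_Rintegral do rewrite d1E.
  rewrite RintegralZl //; last exact: integrable_gauss_wave.
  rewrite -/(gauss_moment 1 a (t + pi / 2)) gauss_momentS mul0r mul0r addr0.
  have -> : gauss_moment 0 a (t + pi / 2 + pi / 2) = - gauss_moment 0 a t.
    rewrite /gauss_moment -mulN1r -RintegralZl //;
      last exact: integrable_gauss_wave.
    apply: eq_Rintegral => x _; rewrite /gauss_wave !addrA !cosDpihalf.
    by rewrite sinD cos_pihalf sin_pihalf; ring.
  by ring.
exact: derivableP.
Qed.

(** By [gauss_moment0_derive], [e^(a^2)] times the moment does not depend on
    [a]; at [a = 0] it is the Gaussian integral times [cos t]. *)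
Lemma gauss_moment0 a t :
  gauss_moment 0 a t = Num.sqrt pi * expR (- a ^+ 2) * cos t.
Proof.
pose E b := expR (b ^+ 2) * gauss_moment 0 b t.
have dE b : is_derive b (1 : R) E 0.
  have := is_deriveM (@is_derive1_comp _ expR (fun x => x ^+ 2) _ _ _
    (is_derive_expR _) (is_derive_powX 2 b)) (gauss_moment0_derive b t).
  by congr is_derive; rewrite /GRing.scale /= expr1; ring.
have : E a = E 0 by exact: is_derive_0_is_cst.
rewrite /E expr0n /= expR0 mul1r => e.
apply: (@mulfI _ (expR (a ^+ 2))); first by rewrite gt_eqF // expR_gt0.
have -> : expR (a ^+ 2) * (Num.sqrt pi * expR (- a ^+ 2) * cos t) =
    Num.sqrt pi * cos t.
  by rewrite expRN; field; rewrite gt_eqF // expR_gt0.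
rewrite e /gauss_moment.
have -> : gauss_wave 0 0 t = (fun x => gauss_fun x * cos t).
  by apply/funext => x; rewrite /gauss_wave expr0 mul1r mulr0 mul0r add0r.
rewrite RintegralZr //; last exact: integrableT_gauss.
by rewrite /Rintegral integralT_gauss.
Qed.

Lemma gauss_momentE k a t :
  gauss_moment k a t =
  Num.sqrt pi * expR (- a ^+ 2) * hermite1 a k * cos (t + k%:R * (pi / 2)).
Proof.
suff : gauss_moment k a t =
    Num.sqrt pi * expR (- a ^+ 2) * hermite1 a k * cos (t + k%:R * (pi / 2)) /\
  gauss_moment k.+1 a t =
    Num.sqrt pi * expR (- a ^+ 2) * hermite1 a k.+1 *
    cos (t + k.+1%:R * (pi / 2)) by case.
elim: k t => [|k IH] t.
  rewrite gauss_momentS !gauss_moment0 /= !mul0r !addr0 !mulr1 mul1r.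
  by split => //; ring.
have [IH1 IH2] := IH t; split=> //.
rewrite gauss_momentS (IH _).2 IH1.
rewrite (hermite1S a k.+1) [k.+1.-1]/= (hermite1S a k).
(* the phase [t + k (pi/2)] of the lower moment lags behind by [pi], which
   turns the plus sign of [gauss_momentS] into the minus of [hermite1S] *)
have -> : t + k.+2%:R * (pi / 2) = t + k%:R * (pi / 2) + pi by field.
have -> : t + pi / 2 + k.+1%:R * (pi / 2) = t + k%:R * (pi / 2) + pi by field.
by rewrite cosDpi; ring.
Qed.

(** * Gaussian moments with a trigonometric factor: the plane *)

Definition gauss_wave2 j l a b t (z : R * R) : R :=
  z.1 ^+ j * z.2 ^+ l *
  (expR (- (z.1 ^+ 2 + z.2 ^+ 2)) * cos (2 * (a * z.1 + b * z.2) + t)).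

(** For fixed [x] the first half of the cosine's argument is only a phase for
    the integral in [y]. *)
Lemma gauss_wave2E j l a b t x y :
  gauss_wave2 j l a b t (x, y) =
  x ^+ j * expR (- x ^+ 2) * gauss_wave l b (2 * a * x + t) y.
Proof.
rewrite /gauss_wave2 /gauss_wave /= opprD expRD.
have -> : 2 * (a * x + b * y) + t = 2 * b * y + (2 * a * x + t) by ring.
by ring.
Qed.

Lemma measurable_gauss_wave2 j l a b t :
  measurable_fun setT (gauss_wave2 j l a b t).
Proof.
have m1 : measurable_fun setT (fst : R * R -> R) := measurable_fst.
have m2 : measurable_fun setT (snd : R * R -> R) := measurable_snd.
apply: measurable_funM.
  by apply: measurable_funM; exact: measurable_funX.
apply: measurable_funM.
  apply: measurableT_comp => //; apply: measurableT_comp => //.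
  by apply: measurable_funD; exact: measurable_funX.
apply: measurableT_comp.
  by apply: continuous_measurable_fun; exact: continuous_cos.
apply: measurable_funD => //; apply: measurable_funM => //.
by apply: measurable_funD; apply: measurable_funM.
Qed.

Lemma integrable_gauss_wave2 j l a b t :
  (@lebesgue2 R).-integrable setT (fun z => (gauss_wave2 j l a b t z)%:E).
Proof.
apply/integrable12ltyP.
  by apply/measurable_EFinP; exact: measurable_gauss_wave2.
pose D := (\int[mu]_y (`|y| ^+ l * expR (- y ^+ 2))%:E)%E.
have Df : D \is a fin_num.
  exact: integrable_fin_num (integrable_abs_gauss R l).
pose N (x : R) := `|x| ^+ j * expR (- x ^+ 2).
have N0 x : 0 <= N x by rewrite mulr_ge0 ?expR_ge0 ?exprn_ge0.
have mN k : measurable_fun setT (fun x : R => `|x| ^+ k * expR (- x ^+ 2)).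
  have /integrableP[+ _] := integrable_abs_gauss R k.
  by move/measurable_EFinP.
have inner x :
    (\int[mu]_y `|(gauss_wave2 j l a b t (x, y))%:E| <= (N x)%:E * D)%E.
  rewrite /D -ge0_integralZl //; first last.
  - by rewrite lee_fin.
  - by apply/measurable_EFinP; exact: mN.
  apply: ge0_le_integral => //.
  - apply: measurableT_comp => //; apply/measurable_EFinP.
    under eq_fun do rewrite gauss_wave2E.
    by apply: measurable_funM => //; exact: measurable_gauss_wave.
  - apply/measurable_EFinP.
    exact: (measurable_funM (measurable_cst (N x)) (mN l)).
  - move=> y _; rewrite gauss_wave2E lee_fin normrM ler_pM //;
      last exact: gauss_wave_le.
    by rewrite normrM normrX [X in _ * X]ger0_norm // expR_ge0.
apply: (@le_lt_trans _ _ (\int[mu]_x ((N x)%:E * D))%E).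
  apply: ge0_le_integral => //.
  - by move=> x _; exact: integral_ge0.
  - apply: (@measurable_fun_fubini_tonelli_F _ _ _ _ _ mu
      (fun z => `|(gauss_wave2 j l a b t z)%:E|)%E) => //.
    apply: measurableT_comp => //.
    by apply/measurable_EFinP; exact: measurable_gauss_wave2.
  - rewrite -(fineK Df); apply/measurable_EFinP.
    exact: (measurable_funM (mN j) (measurable_cst (fine D))).
rewrite -(fineK Df); apply: integrable_lty => //.
have := integrableZl measurableT (fine D) (integrable_abs_gauss R j).
by apply: eq_integrable => // x _; rewrite /= -EFinM mulrC.
Qed.

Lemma integral_gauss_wave2 j l a b t :
  \int[@lebesgue2 R]_z gauss_wave2 j l a b t z =
  pi * expR (- (a ^+ 2 + b ^+ 2)) * (hermite1 a j * hermite1 b l) *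
  cos (t + (j + l)%:R * (pi / 2)).
Proof.
rewrite /Rintegral.
have <- := integral12_prod_meas1 (integrable_gauss_wave2 j l a b t).
have inner x : fubini_F mu (fun z => (gauss_wave2 j l a b t z)%:E) x =
  (Num.sqrt pi * expR (- b ^+ 2) * hermite1 b l *
   gauss_wave j a (t + l%:R * (pi / 2)) x)%:E.
  rewrite /fubini_F.
  have /integrable_fin_num -/(_ measurableT) fin :
      mu.-integrable setT (fun y => (gauss_wave2 j l a b t (x, y))%:E).
    have := integrableZl measurableT (x ^+ j * expR (- x ^+ 2))
      (integrable_gauss_wave l b (2 * a * x + t)).
    by apply: eq_integrable => // y _; rewrite gauss_wave2E.
  rewrite -(fineK fin); congr EFin.
  transitivity (\int[mu]_y (x ^+ j * expR (- x ^+ 2) *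
      gauss_wave l b (2 * a * x + t) y)).
    by apply: eq_Rintegral => y _; rewrite gauss_wave2E.
  rewrite RintegralZl //; last exact: integrable_gauss_wave.
  rewrite -/(gauss_moment l b (2 * a * x + t)) gauss_momentE /gauss_wave addrA.
  by ring.
transitivity (\int[mu]_x (Num.sqrt pi * expR (- b ^+ 2) *
    hermite1 b l * gauss_wave j a (t + l%:R * (pi / 2)) x)).
  by congr fine; apply: eq_integral => x _; exact: inner.
rewrite RintegralZl //; last exact: integrable_gauss_wave.
rewrite -/(gauss_moment j a (t + l%:R * (pi / 2))) gauss_momentE.
rewrite opprD expRD.
have -> : t + l%:R * (pi / 2) + j%:R * (pi / 2) = t + (j + l)%:R * (pi / 2).
  by rewrite natrD; ring.
rewrite -[X in _ = X * _ * _ * _]sqr_sqrtr ?pi_ge0 //.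
by ring.
Qed.

End GaussMoment.

(** * The exponential series on the complex plane *)

Section ComplexExp.
Local Open Scope complex_scope.
Variable R : realType.
Implicit Types (z w : R[i]) (u v t th : R).

(** The real part of [e^(-i th) e^(-(u + i v) t) w].  The free angle [th]
    lets one real function give access to every component of [w]. *)
Definition damped u v th w t : R :=
  expR (- u * t) *
  (cos (v * t + th) * complex.Re w + sin (v * t + th) * complex.Im w).

Lemma is_derive_damped u v th w t :
  is_derive t (1 : R) (damped u v th w) (- damped u v th ((u +i* v) * w) t).
Proof.
have hc := is_deriveM (is_derive_affine_cos v th t)
  (is_derive_cst (complex.Re w) t (1:R)).
have hs := is_deriveM (is_derive_affine_sin v th t)
  (is_derive_cst (complex.Im w) t (1:R)).
have := is_deriveM (is_derive_expR_linear (- u) t) (is_deriveD hc hs).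
congr is_derive; case: w {hc hs} => x y; rewrite /damped /GRing.scale /=.
by rewrite addrfctE !mulrfctE /=; ring.
Qed.

Lemma damped_le u v th w t : `|damped u v th w t| <=
  expR (- u * t) * (`|complex.Re w| + `|complex.Im w|).
Proof.
rewrite normrM ger0_norm ?expR_ge0 // ler_wpM2l ?expR_ge0 //.
apply: le_trans (ler_normD _ _) _; rewrite !normrM.
by apply: lerD; rewrite ler_piMl // ler_norml
  ?cos_geN1 ?cos_le1 ?sin_geN1 ?sin_le1.
Qed.

(** The real part of [e^(-i th) e^(-t z)] times the [N]-th partial sum of the
    exponential series at [t z], for [z = u + i v]. *)
Definition damped_exp_sum u v th N t : R :=
  \sum_(0 <= k < N)
    t ^+ k * damped u v th (k`!%:R^-1%:C * (u +i* v) ^+ k) t.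

(** The derivative of the sum telescopes to its last term. *)
Lemma is_derive_damped_exp_sum u v th N t :
  is_derive t (1 : R) (damped_exp_sum u v th N.+1)
    (- (t ^+ N * damped u v th (N`!%:R^-1%:C * (u +i* v) ^+ N.+1) t)).
Proof.
have dterm k : is_derive t (1 : R)
   (fun t => t ^+ k * damped u v th (k`!%:R^-1%:C * (u +i* v) ^+ k) t)
   (k%:R * t ^+ k.-1 * damped u v th (k`!%:R^-1%:C * (u +i* v) ^+ k) t -
    t ^+ k * damped u v th (k`!%:R^-1%:C * (u +i* v) ^+ k.+1) t).
  have := is_deriveM (is_derive_powX k t)
    (is_derive_damped u v th (k`!%:R^-1%:C * (u +i* v) ^+ k) t).
  by congr is_derive; rewrite mulrCA -exprS /GRing.scale /=; ring.
elim: N => [|N IH].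
  have := dterm 0.
  have -> : damped_exp_sum u v th 1 = (fun t =>
      t ^+ 0 * damped u v th (0`!%:R^-1%:C * (u +i* v) ^+ 0) t).
    by apply/funext => s; rewrite /damped_exp_sum big_nat1.
  by congr is_derive; rewrite !mul0r add0r.
have -> : damped_exp_sum u v th N.+2 = damped_exp_sum u v th N.+1 +
    (fun t => t ^+ N.+1 *
       damped u v th (N.+1`!%:R^-1%:C * (u +i* v) ^+ N.+1) t).
  by apply/funext => s; rewrite /damped_exp_sum big_nat_recr.
have := is_deriveD IH (dterm N.+1).
congr is_derive; rewrite addrA -[RHS]add0r; congr (_ - _).
apply/eqP; rewrite addrC subr_eq0; apply/eqP.
rewrite /= -mulrA mulrCA; congr (_ * _).
rewrite factS natrM invfM rmorphM /= -mulrA /damped.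
case: (_%:C * _ ^+ N.+1) => x y; simpc => /=.
by field; rewrite addrC natr1 pnatr_eq0.
Qed.

Lemma norm_exp_complex_le u v k :
  `|complex.Re ((u +i* v) ^+ k)| <= (`|u| + `|v|) ^+ k /\
  `|complex.Im ((u +i* v) ^+ k)| <= (`|u| + `|v|) ^+ k.
Proof.
elim: k => [|k]; first by rewrite /= !expr0 normr1 normr0.
rewrite !exprS; case: (_ ^+ k) => x y /= [hx hy].
split; rewrite mulrDl.
  apply: le_trans (ler_normB _ _) _; rewrite !normrM.
  by apply: lerD; exact: ler_wpM2l.
apply: le_trans (ler_normD _ _) _; rewrite !normrM.
by apply: lerD; exact: ler_wpM2l.
Qed.

(** The mean value theorem on [0, 1]: the value at [0] is [cos th], and the
    derivative is bounded by a multiple of a general term of an exponential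
    series. *)
Lemma cvg_damped_exp_sum u v th :
  damped_exp_sum u v th N 1 @[N --> \oo] --> cos th.
Proof.
pose M : R := `|u| + `|v|.
pose e N := 2 * expR `|u| * M * (exp_coeff M N).
have bound N : `|damped_exp_sum u v th N.+1 1 - cos th| <= e N.
  have <- : damped_exp_sum u v th N.+1 0 = cos th.
    rewrite /damped_exp_sum big_nat_recl // big1 ?addr0 => [|k _]; last first.
      by rewrite exprS !mul0r.
    rewrite expr0 fact0 /damped mul1r invr1 !mulr0 expR0 add0r /=.
    by simpc => /=; ring.
  have [|c] := @MVT_segment _ (damped_exp_sum u v th N.+1) _ 0 1 ler01
    (fun t _ => is_derive_damped_exp_sum u v th N t).
    apply: continuous_subspaceT.
    have d := is_derive_damped_exp_sum u v th N; move=> x.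
    exact/differentiable_continuous/derivable1_diffP/ex_derive.
  rewrite in_itv /= => /andP[c0 c1] ->; rewrite subr0 mulr1 normrN normrM.
  have [hr hi] := norm_exp_complex_le u v N.+1.
  have -> : e N = expR `|u| * (N`!%:R^-1 * (M ^+ N.+1 + M ^+ N.+1)).
    by rewrite /e /exp_coeff /= exprS; ring.
  rewrite -[leRHS]mul1r ler_pM //.
    by rewrite normrX exprn_ile1 // ger0_norm.
  apply: le_trans (damped_le _ _ _ _ _) _.
  rewrite ler_pM ?expR_ge0 ?addr_ge0 //.
    rewrite ler_expR (le_trans (ler_norm _)) // normrM normrN ler_piMr //.
    by rewrite ger0_norm.
  case: (_ ^+ N.+1) hr hi => x y /= hr hi; simpc.
  rewrite !normrM ger0_norm ?invr_ge0 // -mulrDr.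
  by rewrite ler_wpM2l ?invr_ge0 // lerD.
have e0 : e N @[N --> \oo] --> 0.
  rewrite -[X in _ --> X](mulr0 (2 * expR `|u| * M)); apply: cvgMr.
  exact: (cvg_series_cvg_0 (is_cvg_series_exp_coeff M)).
rewrite -(cvg_shiftS (fun N => damped_exp_sum u v th N 1)).
apply/subr_cvg0; apply: norm_cvg0.
apply: (@squeeze_cvgr _ _ _ _ (cst 0) e) => //; last exact: cvg_cst.
by apply: nearW => N /=; rewrite normr_ge0 bound.
Qed.

Lemma cvg_complex_exp u v :
  complex.Re (\sum_(0 <= k < N) (k`!%:R^-1%:C * (u +i* v) ^+ k))
    @[N --> \oo] --> expR u * cos v /\
  complex.Im (\sum_(0 <= k < N) (k`!%:R^-1%:C * (u +i* v) ^+ k))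
    @[N --> \oo] --> expR u * sin v.
Proof.
pose S N := \sum_(0 <= k < N) (k`!%:R^-1%:C * (u +i* v) ^+ k).
have h th N : expR u * damped_exp_sum u v th N 1 =
    cos (v + th) * complex.Re (S N) + sin (v + th) * complex.Im (S N).
  rewrite /S !raddf_sum !mulr_sumr -big_split; apply: eq_bigr => k _ /=.
  rewrite expr1n mul1r /damped !mulr1 expRN mulrA mulfV ?mul1r //.
  by rewrite gt_eqF // expR_gt0.
have cvgS th : cos (v + th) * complex.Re (S N) + sin (v + th) * complex.Im (S N)
    @[N --> \oo] --> expR u * cos th.
  under eq_fun do rewrite -h.
  by apply: cvgMr; exact: cvg_damped_exp_sum.
(* the angles for which [v + th] is [0] and [pi / 2] *)
split.
- have := cvgS (- v); rewrite cosN subrr cos0 sin0.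
  by under eq_fun do rewrite mul1r mul0r addr0.
- have := cvgS (pi / 2 - v).
  rewrite [v + _]addrC subrK cosB cos_pihalf sin_pihalf mul0r add0r mul1r.
  by under eq_fun do rewrite mul1r mul0r add0r.
Qed.

Definition cis u : R[i] := cos u +i* sin u.

Lemma cis_quarter k : cis (k%:R * (pi / 2)) = 'i%C ^+ k :> R[i].
Proof.
elim: k => [|k IH]; first by rewrite mul0r /cis cos0 sin0.
rewrite exprS -IH /cis -natr1 mulrDl mul1r cosD sinD cos_pihalf sin_pihalf.
by simpc.
Qed.

End ComplexExp.

(** * A slice as a copy of the complex plane *)

Section Slice.
Local Open Scope complex_scope.
Variable R : realType.
Implicit Types (z w : R[i]) (I : quat R) (a u v : R).

Definition slice_embed I z : quat R :=
  (complex.Re z)%:A + complex.Im z *: I.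

Lemma slice_ptE I (p : R * R) : slice_pt I p = slice_embed I (p.1 +i* p.2).
Proof. by []. Qed.

(** [I^2 = -1] forces [2 a b = 2 a c = 2 a d = 0] for the coordinates of [I];
    if [a] were nonzero, [I] would be real and [a^2 = -1]. *)
Lemma imag_units_re I : imag_units I ->
  qre I = 0 /\ qi I ^+ 2 + qj I ^+ 2 + qk I ^+ 2 = 1.
Proof.
rewrite /imag_units /= expr2; case: I => a b c d [].
rewrite /= -[0]/(0 : R) !oppr0 => e1 e2 e3 e4.
have a0 : a = 0.
  have [//|a0] := eqVneq a 0.
  have f x : a * x + x * a = 0 -> x = 0.
    rewrite [x * a]mulrC -mulr2n => /eqP.
    by rewrite mulrn_eq0 /= mulf_eq0 (negbTE a0) => /eqP.
  have b0 : b = 0 by apply: f; move: e2; lra.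
  have c0 : c = 0 by apply: f; move: e3; lra.
  have d0 : d = 0 by apply: f; move: e4; lra.
  have := sqr_ge0 a; move: e1; rewrite b0 c0 d0 expr2; lra.
by split=> //; move: e1; rewrite a0 !expr2; lra.
Qed.

Lemma slice_embedE I z : qre I = 0 -> slice_embed I z =
  Quat (complex.Re z) (complex.Im z * qi I) (complex.Im z * qj I)
       (complex.Im z * qk I).
Proof. by case: I => a b c d /= ->; congr Quat => /=; ring. Qed.

Lemma slice_embedD I z w :
  slice_embed I (z + w) = slice_embed I z + slice_embed I w.
Proof. by rewrite /slice_embed !raddfD /= !scalerDl addrACA. Qed.

Lemma slice_embed0 I : slice_embed I 0 = 0.
Proof. by rewrite /slice_embed !scale0r addr0. Qed.

Lemma slice_embed1 I : slice_embed I 1 = 1.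
Proof. by rewrite /slice_embed scale1r scale0r addr0. Qed.

Lemma slice_embedi I : slice_embed I 'i = I.
Proof. by rewrite /slice_embed scale0r add0r scale1r. Qed.

Lemma slice_embed_real I a : slice_embed I a%:C = a%:A.
Proof. by rewrite /slice_embed scale0r addr0. Qed.

Lemma slice_embedN I z : slice_embed I (- z) = - slice_embed I z.
Proof. by apply/eqP; rewrite -addr_eq0 -slice_embedD addNr slice_embed0. Qed.

Lemma slice_embedZ I a z : slice_embed I (a%:C * z) = a *: slice_embed I z.
Proof.
by case: z => x y; simpc; rewrite /slice_embed /= scalerDr !scalerA.
Qed.

Lemma slice_embedM I z w : imag_units I ->
  slice_embed I (z * w) = slice_embed I z * slice_embed I w.
Proof.
move=> /imag_units_re[I0 I1]; rewrite !slice_embedE //.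
case: z w => x y [x' y'] /=; congr Quat => /=; try ring.
have -> : x * x' - y * y' =
    x * x' - y * y' * (qi I ^+ 2 + qj I ^+ 2 + qk I ^+ 2) by rewrite I1 mulr1.
by ring.
Qed.

Lemma slice_embedX I z k : imag_units I ->
  slice_embed I (z ^+ k) = slice_embed I z ^+ k.
Proof.
move=> hI; elim: k => [|k IH]; first exact: slice_embed1.
by rewrite !exprS slice_embedM // IH.
Qed.

Lemma slice_embed_sum I (J : Type) (r : seq J) P (f : J -> R[i]) :
  slice_embed I (\sum_(j <- r | P j) f j) =
  \sum_(j <- r | P j) slice_embed I (f j).
Proof. exact: (big_morph _ (slice_embedD I) (slice_embed0 I)). Qed.

Lemma slice_embed_conj I z : imag_units I ->
  qconj (slice_embed I z) = slice_embed I z^*.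
Proof.
move=> /imag_units_re[I0 _]; rewrite !slice_embedE //.
by case: z => x y /=; congr Quat; rewrite /= mulNr.
Qed.

Lemma qnorm_slice_embed I z : imag_units I ->
  qnorm (slice_embed I z) ^+ 2 = complex.Re z ^+ 2 + complex.Im z ^+ 2.
Proof.
move=> hI; have E : slice_embed I z * qconj (slice_embed I z) =
    (complex.Re z ^+ 2 + complex.Im z ^+ 2)%:A.
  rewrite slice_embed_conj // -slice_embedM //; case: z => x y; simpc.
  by rewrite /slice_embed /= [y * x]mulrC addNr scale0r addr0 !expr2.
rewrite /qnorm E sqr_sqrtr /= ?mulr1 //.
by rewrite addr_ge0 ?sqr_ge0.
Qed.

Lemma qexp_slice_embed I u v : imag_units I ->
  qexp (slice_embed I (u +i* v)) = slice_embed I ((expR u)%:C * cis v).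
Proof.
move=> hI; have [I0 _] := imag_units_re hI.
have [hr hi] := cvg_complex_exp u v.
pose S N : R[i] := \sum_(0 <= k < N) (k`!%:R^-1)%:C * (u +i* v) ^+ k.
rewrite /qexp (_ : (fun N : nat => _) = (fun N => Quat (complex.Re (S N))
    (complex.Im (S N) * qi I) (complex.Im (S N) * qj I)
    (complex.Im (S N) * qk I))).
  rewrite /qlim slice_embedE //; simpc => /=.
  by congr Quat; apply/cvg_lim => //; exact: cvgMl.
apply/funext => N; rewrite -slice_embedE // slice_embed_sum.
by apply: eq_bigr => k _; rewrite slice_embedZ slice_embedX.
Qed.

Lemma hermiteQ_slice_embed I m n z : imag_units I ->
  hermiteQ m n (slice_embed I z) = slice_embed I (hermite2 m n z z^*).
Proof.
move=> hI; rewrite /hermiteQ /hermite2 slice_embed_sum; apply: eq_bigr => k _.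
rewrite slice_embed_conj // -!slice_embedX // -slice_embedM // -slice_embedZ.
congr (slice_embed I (_ * _)).
by rewrite !rmorphM rmorphXn rmorphN1 !rmorph_nat.
Qed.

End Slice.

(** * The complex integral *)

Section RintegralSum.
Context d (T : measurableType d) (R : realType).
Variable mu : {measure set T -> \bar R}.

Lemma Rintegral_sumr n (f : nat -> T -> R) :
  (forall i, mu.-integrable setT (fun x => (f i x)%:E)) ->
  mu.-integrable setT (fun x => (\sum_(i < n) f i x)%:E) /\
  \int[mu]_x (\sum_(i < n) f i x) = \sum_(i < n) \int[mu]_x f i x.
Proof.
move=> intf; elim: n => [|n [IH1 IH2]].
  under eq_fun do rewrite big_ord0.
  split; first exact: integrable0.
  under eq_Rintegral do rewrite big_ord0.
  by rewrite big_ord0 Rintegral_cst // mul0r.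
have E : (fun x => \sum_(i < n.+1) f i x) =
    (fun x => \sum_(i < n) f i x + f n x).
  by apply/funext => x; rewrite big_ord_recr.
split.
  under eq_fun do rewrite big_ord_recr EFinD /=.
  exact: integrableD.
rewrite E RintegralD //; first by rewrite [RHS]big_ord_recr -IH2.
exact: intf.
Qed.

Lemma Rintegral_lincomb p q (f g : T -> R) :
  mu.-integrable setT (fun x => (f x)%:E) ->
  mu.-integrable setT (fun x => (g x)%:E) ->
  mu.-integrable setT (fun x => (p * f x + q * g x)%:E) /\
  \int[mu]_x (p * f x + q * g x) = p * \int[mu]_x f x + q * \int[mu]_x g x.
Proof.
move=> intf intg.
have intZ c h : mu.-integrable setT (fun x => (h x)%:E) ->
    mu.-integrable setT (fun x => (c * h x)%:E).
  by move=> inth; have := integrableZl measurableT c inth; apply: eq_integrable.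
split; last by rewrite RintegralD ?RintegralZl //; exact: intZ.
under eq_fun do rewrite EFinD.
by apply: integrableD => //; exact: intZ.
Qed.

End RintegralSum.

Section ComplexIntegral.
Local Open Scope complex_scope.
Variable R : realType.
Implicit Types a b x y : R.

Definition complex_integrand m n a b (p : R * R) : R[i] :=
  (p.1 +i* p.2) ^+ m * (p.1 -i* p.2) ^+ n *
  ((expR (- (p.1 ^+ 2 + p.2 ^+ 2)))%:C * cis (2 * (a * p.1 + b * p.2))).

Lemma complex_lincomb n (c : nat -> R[i]) (u v : nat -> R) :
  \sum_(j < n) c j * (u j +i* v j) =
  (\sum_(j < n) (complex.Re (c j) * u j + - complex.Im (c j) * v j)) +i*
  (\sum_(j < n) (complex.Re (c j) * v j + complex.Im (c j) * u j)).
Proof.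
elim: n => [|n IH]; first by rewrite !big_ord0.
rewrite !big_ord_recr IH /=; case: (c n) => x y; simpc => /=.
by congr (_ +i* _); ring.
Qed.

(** The phase [- (pi / 2)] turns the cosine of [gauss_wave2] into the sine. *)
Lemma complex_integrandE m n a b p :
  let c := split_poly 'i m n in
  let W t j := gauss_wave2 j (m + n - j) a b t p in
  complex_integrand m n a b p =
  (\sum_(j < (m + n).+1)
     (complex.Re c`_j * W 0 j + (- complex.Im c`_j) * W (- (pi / 2)) j)) +i*
  (\sum_(j < (m + n).+1)
     (complex.Re c`_j * W (- (pi / 2)) j + complex.Im c`_j * W 0 j)).
Proof.
case: p => x y c W.
have W0 j : W 0 j = x ^+ j * y ^+ (m + n - j) *
    (expR (- (x ^+ 2 + y ^+ 2)) * cos (2 * (a * x + b * y))).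
  by rewrite /W /gauss_wave2 addr0.
have W1 j : W (- (pi / 2)) j = x ^+ j * y ^+ (m + n - j) *
    (expR (- (x ^+ 2 + y ^+ 2)) * sin (2 * (a * x + b * y))).
  by rewrite /W /gauss_wave2 cosBpihalf.
have -> : complex_integrand m n a b (x, y) =
    \sum_(j < (m + n).+1) c`_j * (W 0 j +i* W (- (pi / 2)) j).
  rewrite /complex_integrand /=.
  have -> : x +i* y = x%:C + 'i * y%:C by simpc.
  have -> : x -i* y = x%:C - 'i * y%:C by simpc.
  rewrite -homog_monomial /homog mulr_suml; apply: eq_bigr => j _.
  rewrite -mulrA -!(rmorphXn (real_complex R)) /=; congr (_ * _).
  by rewrite W0 W1 /cis; simpc; congr (_ +i* _); ring.
by rewrite (complex_lincomb _ (fun j => c`_j)).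
Qed.

Lemma hermite1_real a k : hermite1 a%:C k = (hermite1 a k)%:C.
Proof.
suff : hermite1 a%:C k = (hermite1 a k)%:C /\
  hermite1 a%:C k.+1 = (hermite1 a k.+1)%:C by case.
elim: k => [//|k [IH1 IH2]]; split=> //.
rewrite !(hermite1S _ k.+1) IH2 [k.+1.-1]/= IH1.
by rewrite rmorphB !rmorphM /= fmorphV /= !rmorph_nat.
Qed.

(** Term by term integration replaces [x^j y^l] by the Hermite table, with the
    common factor [cis ((m + n) pi / 2) = 'i ^+ (m + n)]. *)
Lemma complex_integral m n a b :
  [/\ (@lebesgue2 R).-integrable setT
        (fun p => (complex.Re (complex_integrand m n a b p))%:E),
      (@lebesgue2 R).-integrable setT
        (fun p => (complex.Im (complex_integrand m n a b p))%:E) &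
      (\int[@lebesgue2 R]_p complex.Re (complex_integrand m n a b p)) +i*
      (\int[@lebesgue2 R]_p complex.Im (complex_integrand m n a b p)) =
      (pi * expR (- (a ^+ 2 + b ^+ 2)))%:C * 'i ^+ (m + n) *
      hermite2 m n (a +i* b) (a -i* b)].
Proof.
pose c := split_poly ('i : R[i]) m n; pose N := (m + n)%N.
pose W t j := gauss_wave2 j (N - j) a b t : R * R -> R.
have intW t j : (@lebesgue2 R).-integrable setT (fun p => (W t j p)%:E).
  exact: integrable_gauss_wave2.
have intre j := Rintegral_lincomb (complex.Re c`_j) (- complex.Im c`_j)
  (intW 0 j) (intW (- (pi / 2)) j).
have intim j := Rintegral_lincomb (complex.Re c`_j) (complex.Im c`_j)
  (intW (- (pi / 2)) j) (intW 0 j).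
have [ire sre] := Rintegral_sumr N.+1 (fun j => (intre j).1).
have [iim sim] := Rintegral_sumr N.+1 (fun j => (intim j).1).
have Ere : (fun p => complex.Re (complex_integrand m n a b p)) =
    (fun p => \sum_(j < N.+1) (complex.Re c`_j * W 0 j p +
      - complex.Im c`_j * W (- (pi / 2)) j p)).
  by apply/funext => p; rewrite complex_integrandE.
have Eim : (fun p => complex.Im (complex_integrand m n a b p)) =
    (fun p => \sum_(j < N.+1) (complex.Re c`_j * W (- (pi / 2)) j p +
      complex.Im c`_j * W 0 j p)).
  by apply/funext => p; rewrite complex_integrandE.
split.
- rewrite (_ : (fun p => _) =
    EFin \o (fun p => complex.Re (complex_integrand m n a b p))) //.
  by rewrite Ere.
- rewrite (_ : (fun p => _) =
    EFin \o (fun p => complex.Im (complex_integrand m n a b p))) //.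
  by rewrite Eim.
rewrite Ere Eim sre sim.
pose K := pi * expR (- (a ^+ 2 + b ^+ 2)).
pose g t j := K * (hermite1 a j * hermite1 b (N - j)) *
  cos (t + N%:R * (pi / 2)).
have J t (j : 'I_N.+1) : \int[@lebesgue2 R]_p W t j p = g t j.
  by rewrite /W integral_gauss_wave2 subnKC // -ltnS.
transitivity (\sum_(j < N.+1) c`_j * (g 0 j +i* g (- (pi / 2)) j)).
  rewrite (complex_lincomb _ (fun j => c`_j)).
  by congr (_ +i* _); apply: eq_bigr => j _; rewrite ((intre j).2, (intim j).2) !J.
rewrite -/N -/K -cis_quarter.
have -> : a +i* b = a%:C + 'i * b%:C by simpc.
have -> : a -i* b = a%:C - 'i * b%:C by simpc.
rewrite -homog_hermite ?sqr_i // /homog mulr_sumr; apply: eq_bigr => j _.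
rewrite /hermite_table !hermite1_real /g add0r [- _ + _]addrC cosBpihalf.
rewrite /cis -/c -/N.
by rewrite [RHS]mulrCA; congr (_ * _); simpc; congr (_ +i* _); ring.
Qed.

End ComplexIntegral.

(** * The integral representation *)

Section Representation.
Local Open Scope complex_scope.
Variable R : realType.
Implicit Types (a b eps : R) (I : quat R).

Lemma slice_integrandE m n I a b eps p : imag_units I ->
  let q := slice_embed I (a +i* b) in
  let xi := slice_pt I p in
  xi ^+ m * qconj xi ^+ n *
    qexp (- (qnorm xi ^+ 2)%:A +
          eps *: (I * (xi * qconj q + qconj xi * q))) =
  slice_embed I (complex_integrand m n (eps * a) (eps * b) p).
Proof.
move=> hI q xi.
rewrite /xi /q slice_ptE qnorm_slice_embed // !slice_embed_conj //.
rewrite -[X in eps *: (X * _)](slice_embedi I).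
rewrite -!slice_embedM // -slice_embedD -slice_embedM // -slice_embedZ.
rewrite -(slice_embed_real I) -slice_embedN -slice_embedD.
rewrite -!slice_embedX // -slice_embedM //.
set w := (X in qexp (slice_embed I X)).
have -> : w = - (p.1 ^+ 2 + p.2 ^+ 2) +i*
    (2 * (eps * a * p.1 + eps * b * p.2)).
  by rewrite /w; simpc => /=; congr (_ +i* _); ring.
by rewrite qexp_slice_embed // -slice_embedM.
Qed.

(** An integral of slice values is taken through [slice_embed], because the
    imaginary coordinates are fixed multiples of one real function. *)
Lemma slice_integral_embed I (F : quat R -> quat R) (G : R * R -> R[i]) :
  imag_units I -> (forall p, F (slice_pt I p) = slice_embed I (G p)) ->
  (@lebesgue2 R).-integrable setT (fun p => (complex.Re (G p))%:E) ->
  (@lebesgue2 R).-integrable setT (fun p => (complex.Im (G p))%:E) ->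
  slice_integrable I F /\
  slice_integral I F = slice_embed I
    ((\int[@lebesgue2 R]_p complex.Re (G p)) +i*
     (\int[@lebesgue2 R]_p complex.Im (G p))).
Proof.
move=> hI FE intre intim; have [I0 _] := imag_units_re hI.
have reG : (fun p => qre (F (slice_pt I p))) = (fun p => complex.Re (G p)).
  by apply/funext => p; rewrite FE slice_embedE.
have imG (f : quat R -> R) :
    (forall z, f (slice_embed I z) = complex.Im z * f I) ->
    (fun p => f (F (slice_pt I p))) = (fun p => complex.Im (G p) * f I).
  by move=> fE; apply/funext => p; rewrite FE fE.
have iG := imG (@qi R) (fun z => congr1 (@qi R) (slice_embedE z I0)).
have jG := imG (@qj R) (fun z => congr1 (@qj R) (slice_embedE z I0)).
have kG := imG (@qk R) (fun z => congr1 (@qk R) (slice_embedE z I0)).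
have intimr r :
    (@lebesgue2 R).-integrable setT (fun p => (complex.Im (G p) * r)%:E).
  have := integrableZl measurableT r intim.
  by apply: eq_integrable => // p _; rewrite -EFinM mulrC.
split; last by rewrite slice_embedE // /slice_integral reG iG jG kG !RintegralZr.
have E (f g : R * R -> R) : f = g ->
    (@lebesgue2 R).-integrable setT (fun p => (g p)%:E) ->
    (@lebesgue2 R).-integrable setT (fun p => (f p)%:E) by move=> ->.
by split; [exact: E reG _ | exact: E iG _ | exact: E jG _ | exact: E kG _].
Qed.

(** The prefactor undoes the phase, the sign and the Gaussian constants. *)
Lemma prefactor_cancel N a b eps (h : R[i]) : eps ^+ 2 = 1 ->
  (- (eps%:C * 'i)) ^+ N * (pi^-1)%:C * (expR (a ^+ 2 + b ^+ 2))%:C *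
  ((pi * expR (- (a ^+ 2 + b ^+ 2)))%:C * 'i ^+ N * (eps%:C ^+ N * h)) = h.
Proof.
move=> eps2.
have epsC : eps%:C ^+ 2 = 1 :> R[i] by rewrite -rmorphXn eps2.
have u1 : (- (eps%:C * 'i)) ^+ N * 'i ^+ N * eps%:C ^+ N = 1 :> R[i].
  have cancel (e i : R[i]) : - (e * i) * i * e = - (e ^+ 2 * i ^+ 2) by ring.
  by rewrite -!exprMn cancel epsC sqr_i mulrN1 opprK expr1n.
have u2 : (pi^-1)%:C * (expR (a ^+ 2 + b ^+ 2))%:C *
    (pi * expR (- (a ^+ 2 + b ^+ 2)))%:C = 1 :> R[i].
  rewrite -!rmorphM /= -(rmorph1 (real_complex R)); congr (_%:C).
  rewrite expRN mulrACA mulVf ?mul1r ?mulfV //.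
    by rewrite lt0r_neq0 ?expR_gt0.
  by rewrite lt0r_neq0 ?pi_gt0.
have regroup (x y z r s t : R[i]) :
    x * r * s * (t * y * (z * h)) = x * y * z * (r * s * t) * h by ring.
by rewrite regroup u1 u2 !mul1r.
Qed.

Lemma hermiteQ_integral m n I a b eps : imag_units I -> eps ^+ 2 = 1 ->
  let q := slice_embed I (a +i* b) in
  let F := fun xi : quat R =>
    xi ^+ m * qconj xi ^+ n *
    qexp (- (qnorm xi ^+ 2)%:A + eps *: (I * (xi * qconj q + qconj xi * q))) in
  slice_integrable I F /\
  hermiteQ m n q =
    (- (eps *: I)) ^+ (m + n) * (pi^-1)%:A * (expR (qnorm q ^+ 2))%:A *
    slice_integral I F.
Proof.
move=> hI eps2 q F.
have [intre intim val] := complex_integral m n (eps * a) (eps * b).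
have FE p : F (slice_pt I p) =
    slice_embed I (complex_integrand m n (eps * a) (eps * b) p).
  exact: slice_integrandE.
have [intF ->] := slice_integral_embed hI FE intre intim.
split=> //.
rewrite val qnorm_slice_embed // hermiteQ_slice_embed //.
rewrite -[X in eps *: X](slice_embedi I) -!(slice_embed_real I).
rewrite -slice_embedZ -slice_embedN -slice_embedX // -!slice_embedM //.
congr slice_embed.
have -> : eps * a +i* (eps * b) = eps%:C * (a +i* b) by simpc.
have -> : eps * a -i* (eps * b) = eps%:C * (a +i* b)^* by simpc.
rewrite hermite2_sign /=; last by rewrite -rmorphXn eps2.
by rewrite !exprMn eps2 !mul1r prefactor_cancel.
Qed.

End Representation.

Unset Implicit Arguments.

Theorem lemma3p3 (R : realType) (m n : nat) (I q : quat R) (eps : R)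
    (hI : imag_units I) (hq : slice I q) (heps : eps = 1 \/ eps = -1) :
  let F := fun xi : quat R =>
    xi ^+ m * qconj xi ^+ n *
    qexp (- (qnorm xi ^+ 2)%:A + eps *: (I * (xi * qconj q + qconj xi * q))) in
  slice_integrable I F /\
  hermiteQ m n q =
    (- (eps *: I)) ^+ (m + n) * (pi^-1)%:A * (expR (qnorm q ^+ 2))%:A *
    slice_integral I F.
Proof.
case: hq => -[a b] _ <-; rewrite slice_ptE.
apply: hermiteQ_integral => //.
by case: heps => ->; rewrite ?sqrrN expr1n.
Qed.
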